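(* The numbers $P_{1^{-3}2^{3}3^{1}6^{-1}}(n)$, defined by $\sum_{n\ge0}P_{1^{-3}2^{3}3^{1}6^{-1}}(n)q^n=\frac{f_2^3f_3}{f_1^3f_6}$, form a $2$-convolutive sequence.
   Context: $f_i:=(q^i;q^i)_\infty=\prod_{k\ge1}(1-q^{ik})$. A sequence $(a_n)_{n\ge0}$ is $m$-convolutive if $\sum_{n\ge0}a_{mn}q^n=\big(\sum_{n\ge0}a_nq^n\big)^m$. *)

(* Defs.v *)
(* Formal power series over int are represented by their
   coefficient sequences nat -> int. *)
From HB Require Import structures.
From mathcomp Require Import all_boot all_order all_algebra.
Set Implicit Arguments. Unset Strict Implicit. Unset Printing Implicit Defensive.
Import Order.TTheory GRing.Theory Num.Theory.
Local Open Scope ring_scope.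

Definition fps_mul (a b : nat -> int) : nat -> int :=
  fun n => \sum_(j < n.+1) a j * b (n - j)%N.

Fixpoint fps_exp (a : nat -> int) (m : nat) : nat -> int :=
  match m with
  | 0%N => fun n => if n == 0%N then 1 else 0
  | m'.+1 => fps_mul a (fps_exp a m')
  end.

(* f_i = (q^i;q^i)_oo = prod_{k>=1} (1 - q^{ik}).  The coefficient of q^n
   only depends on the factors with k <= n (for i >= 1), so it equals the
   n-th coefficient of the finite product prod_{k=1}^{n} (1 - X^{ik}). *)
Definition f_ (i : nat) : nat -> int :=
  fun n => (\prod_(1 <= k < n.+1) (1 - 'X^(i * k)) : {poly int})`_n.

Definition convolutive (m : nat) (a : nat -> int) : Prop :=
  forall n, a (m * n)%N = fps_exp a m n.

(* Main.v *)
(* Write [theta_w(q) = sum_(j in Z) w^j q^(j^2)], and let [w] be a primitive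
   sixth root of unity, so that [w + 1/w = 1].  By the Jacobi triple product,
   [theta_(-1)(q) = f_1^2 / f_2] and [theta_w(q) = f_2^2 f_3 / (f_1 f_6)], hence
   the generating function [A] satisfies [A(q) theta_(-1)(q) = theta_w(q)].
   The substitution [(j, k) = (r - s, r + s)] shows that the even part of
   [theta_1(q) theta_u(q)] is [theta_u(q^2)^2] for every [u].  The series
   [theta_1(q) theta_(-1)(q)] is even, so taking even parts in
   [A(q) theta_1(q) theta_(-1)(q) = theta_1(q) theta_w(q)] and writing [E(q)] for
   [sum a_(2n) q^n] yields
   [E(q) theta_(-1)(q)^2 = theta_w(q)^2 = A(q)^2 theta_(-1)(q)^2].
   Power series are handled as polynomials over [algC] modulo a power of ['X]. *)
Require Import Defs.
From mathcomp Require Import all_boot all_order all_algebra.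
From mathcomp Require Import all_field zify ring.
Set Implicit Arguments. Unset Strict Implicit. Unset Printing Implicit Defensive.
Import GRing.Theory Num.Theory.
Local Open Scope ring_scope.

(** * The finite q-binomial theorem *)

Section QBinomial.
Variables (R : comNzRingType) (t : R).

Definition tpoch (n : nat) : R := \prod_(i < n) (1 - t ^+ i.+1).

(* [qbin m k] is [t ^ (k(k-1)/2)] times the Gaussian binomial [m choose k]. *)
Fixpoint qbin (m k : nat) : R :=
  match m, k with
  | _, 0 => 1
  | 0, _.+1 => 0
  | m'.+1, k'.+1 => qbin m' k'.+1 + t ^+ m' * qbin m' k'
  end.

Lemma tpochS n : tpoch n.+1 = tpoch n * (1 - t ^+ n.+1).
Proof. by rewrite /tpoch big_ord_recr. Qed.

Lemma qbin0 m : qbin m 0 = 1. Proof. by case: m. Qed.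

Lemma qbin_small m k : (m < k)%N -> qbin m k = 0.
Proof.
elim: m k => [|m IH] [|k] //= lt_mk.
by rewrite !IH ?mulr0 ?addr0 // ltnW.
Qed.

(** Pascal-type induction; denominators are cleared because [R] is only a commutative ring. *)
Lemma qbin_tpoch m k : (k <= m)%N ->
  qbin m k * tpoch k * tpoch (m - k) = t ^+ 'C(k, 2) * tpoch m.
Proof.
elim: m k => [|m IH] [|k] //= le_km.
- by rewrite /tpoch !big_ord0 bin0n !mulr1.
- by rewrite subn0 bin0n expr0 /tpoch big_ord0 mulr1.
rewrite subSS binS bin1.
have step : qbin m k.+1 * tpoch k.+1 * tpoch (m - k) =
    t ^+ ('C(k, 2) + k) * tpoch m * (1 - t ^+ (m - k)).
  have [eq_mk|lt_km] := leqP m k.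
    have -> : k = m by lia.
    by rewrite qbin_small // subnn expr0 subrr mulr0 !mul0r.
  have -> : (m - k = (m - k.+1).+1)%N by lia.
  by rewrite [tpoch (m - k.+1).+1]tpochS mulrA IH // binS bin1.
rewrite mulrDl mulrDl step tpochS.
have -> : t ^+ m * qbin m k * (tpoch k * (1 - t ^+ k.+1)) * tpoch (m - k) =
    t ^+ m * (1 - t ^+ k.+1) * (t ^+ 'C(k, 2) * tpoch m).
  by rewrite -IH //; ring.
have em : t ^+ m = t ^+ k * t ^+ (m - k) by rewrite -exprD subnKC.
by rewrite tpochS exprD (exprS t k) (exprS t m) em; ring.
Qed.

(** Splitting off the last factor of the product reproduces the recursion of [qbin]. *)
Lemma qbin_theorem (a b : R) m :
  \prod_(i < m) (a + b * t ^+ i) =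
    \sum_(k < m.+1) qbin m k * a ^+ (m - k) * b ^+ k.
Proof.
elim: m => [|m IH]; first by rewrite big_ord0 big_ord1 !mulr1.
rewrite big_ord_recr IH /= [RHS]big_ord_recl /= subn0 mul1r mulr1.
under [X in _ = _ + X]eq_bigr => i _ do rewrite /bump /= add1n subSS !mulrDl.
rewrite big_split /= addrA mulrDr; congr (_ + _).
  rewrite [in RHS]big_ord_recr /= qbin_small // !mul0r addr0.
  rewrite mulr_suml big_ord_recl /= subn0 qbin0 mul1r mulr1 -exprSr.
  congr (_ + _); apply: eq_bigr => i _; rewrite /bump /= add1n.
  have -> : (m - i = (m - i.+1).+1)%N by case: i => i /=; lia.
  by rewrite [in RHS]exprSr; ring.
by rewrite mulr_suml; apply: eq_bigr => i _; rewrite exprSr; ring.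
Qed.

Lemma tpoch_double n :
  \prod_(i < n) (1 - t ^+ i.*2.+1) * \prod_(i < n) (1 - t ^+ 2 ^+ i.+1)
  = tpoch n.*2.
Proof.
elim: n => [|n IH]; first by rewrite /tpoch !big_ord0 mulr1.
by rewrite !big_ord_recr doubleS !tpochS -IH -exprM mul2n doubleS /=; ring.
Qed.

End QBinomial.

(** * Polynomials modulo a power of ['X] *)

Section Truncation.
Variable F : fieldType.
Implicit Types p q r : {poly F}.

Definition eqX (N : nat) p q := 'X^N %| p - q.

Lemma eqXP N p q : reflect (forall i, (i < N)%N -> p`_i = q`_i) (eqX N p q).
Proof.
apply: (iffP idP) => [/dvdpP[r def_r] i lt_iN|eq_pq].
  by apply/eqP; rewrite -subr_eq0 -coefB def_r coefMXn lt_iN.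
apply/dvdpP; exists (\poly_(i < size (p - q)) (p - q)`_(i + N)).
apply/polyP => i; rewrite coefMXn coef_poly.
case: ltnP => [lt_iN|le_Ni]; first by rewrite coefB eq_pq ?subrr.
rewrite subnK //; case: ltnP => // le_pq.
by rewrite nth_default // (leq_trans le_pq) // leq_subr.
Qed.

Lemma eqX_refl N p : eqX N p p. Proof. by rewrite /eqX subrr dvdp0. Qed.

Lemma eqX_sym N p q : eqX N p q -> eqX N q p.
Proof. by rewrite /eqX -opprB dvdpNr. Qed.

Lemma eqX_trans N q p r : eqX N p q -> eqX N q r -> eqX N p r.
Proof.
by rewrite /eqX => pq qr; rewrite -(subrK q p) -addrA dvdp_add.
Qed.

Lemma eqXM N p q p' q' : eqX N p p' -> eqX N q q' -> eqX N (p * q) (p' * q').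
Proof.
rewrite /eqX => pp qq.
have -> : p * q - p' * q' = (p - p') * q + p' * (q - q') by ring.
by apply: dvdp_add; [apply: dvdp_mulr | apply: dvdp_mull].
Qed.

Lemma eqXX N p q k : eqX N p q -> eqX N (p ^+ k) (q ^+ k).
Proof.
by move=> pq; elim: k => [|k IH]; rewrite ?eqX_refl // !exprS eqXM.
Qed.

Lemma eqX_sum N (I : finType) (p q : I -> {poly F}) :
  (forall i, eqX N (p i) (q i)) -> eqX N (\sum_i p i) (\sum_i q i).
Proof.
move=> pq; rewrite /eqX -sumrB; apply: (big_ind (fun r => 'X^N %| r)) => //.
- by move=> *; apply: dvdp_add.
- by move=> i _; apply: pq.
Qed.

Lemma eqX_leq M N p q : (M <= N)%N -> eqX N p q -> eqX M p q.
Proof. by move=> le_MN; apply/dvdp_trans/dvdp_exp2l. Qed.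

Lemma eqX_mulXn N k p q : eqX N p q -> eqX (k + N) ('X^k * p) ('X^k * q).
Proof.
by rewrite /eqX -mulrBr exprD dvdp_mul2l // -size_poly_eq0 size_polyXn.
Qed.

Lemma eqX_cancelXn N k p q : eqX (k + N) ('X^k * p) ('X^k * q) -> eqX N p q.
Proof.
by rewrite /eqX -mulrBr exprD dvdp_mul2l // -size_poly_eq0 size_polyXn.
Qed.

(** A nonzero constant term makes [r] coprime to every power of ['X]. *)
Lemma eqX_cancel N r p q : r`_0 != 0 -> eqX N (r * p) (r * q) -> eqX N p q.
Proof.
move=> r0; rewrite /eqX -mulrBr Gauss_dvdpr //.
by rewrite coprimep_expl // coprimep_sym coprimepX /root horner_coef0.
Qed.

Lemma tpoch_coef0 k n : (0 < k)%N -> (tpoch ('X^k : {poly F}) n)`_0 = 1.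
Proof.
move=> k0; rewrite /tpoch -horner_coef0 horner_prod big1 // => i _.
by rewrite !hornerE -exprM expr0n muln_eq0 /= -leqn0 leqNgt k0 subr0.
Qed.

(** Each extra factor is 1 - X^(kj) with j > m, hence congruent to 1 at this order. *)
Lemma eqX_tpoch k m n : (m <= n)%N ->
  eqX (k * m.+1) (tpoch 'X^k n) (tpoch ('X^k : {poly F}) m).
Proof.
move=> /subnK <-; elim: (n - m)%N => [|d IH]; first exact: eqX_refl.
rewrite addSn tpochS; apply: eqX_trans IH.
rewrite /eqX mulrBr mulr1 addrC addKr dvdpNr dvdp_mull // -exprM dvdp_exp2l //.
by rewrite leq_mul2l; apply/orP; right; lia.
Qed.

End Truncation.

(** * The truncated Jacobi triple product *)

Section JacobiTripleProduct.
Variable F : fieldType.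
Implicit Type w : F.

(** This is (k - n)^2: at least one of the two natural differences is zero. *)
Definition sqdist (k n : nat) : nat := ((k - n) + (n - k)) ^ 2.

Definition tprod w n : {poly F} :=
  \prod_(i < n) ((1 + w *: 'X^(i.*2.+1)) * (1 + w^-1 *: 'X^(i.*2.+1)))
  * tpoch 'X^2 n.

(* [theta w n] is the truncation [sum_(|j| <= n) w ^ j X ^ (j ^ 2)], the
   summation index being [k = n + j]. *)
Definition theta w n : {poly F} :=
  \sum_(k < n.*2.+1) (w ^+ k / w ^+ n) *: 'X^(sqdist k n).

(** The left side is the explicit power of X in the k-th term of [qbin_theorem] for t = X^2, a =
    X^(2n-1), b = w, m = 2n; the right side isolates the part common to all k. *)
Lemma jacobi_exponent n k : (k <= n.*2)%N ->
  (2 * 'C(k, 2) + n.*2.-1 * (n.*2 - k) =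
   n * n.-1 + n * n.*2.-1 + sqdist k n)%N.
Proof.
case: n => [|n] le_k; first by move: le_k; rewrite leqn0 => /eqP ->.
have eC : (2 * 'C(k, 2) + k = k * k)%N.
  by elim: k {le_k} => // k; rewrite binS bin1; lia.
have -> : (n.+1.*2.-1 = n.*2.+1)%N by lia.
rewrite /sqdist -mulnn /=; have [le_kn|/ltnW le_nk] := leqP k n.+1.
  have [d def_n] : exists d, n.+1 = (k + d)%N by exists (n.+1 - k)%N; lia.
  have -> : (n.+1.*2 - k = n.+1 + d)%N by lia.
  have -> : (k - n.+1 + (n.+1 - k) = d)%N by lia.
  have := congr1 (fun x => x * x)%N def_n; have := congr1 (muln d) def_n; lia.
have [d def_k] : exists d, k = (n.+1 + d)%N by exists (k - n.+1)%N; lia.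
have [e def_n] : exists e, n.+1 = (d + e)%N by exists (n.+1 - d)%N; lia.
have -> : (n.+1.*2 - k = e)%N by lia.
have -> : (k - n.+1 + (n.+1 - k) = d)%N by lia.
have := congr1 (fun x => x * x)%N def_n; have := congr1 (muln d) def_n.
have := congr1 (muln e) def_n; subst k; lia.
Qed.

(** Pull w X^(2i) out of the factors with i < n, and X^(2n-1) out of the others. *)
Lemma jacobi_product w n : w != 0 ->
  \prod_(i < n.*2) ('X^(n.*2.-1) + w%:P * 'X^2 ^+ i) =
  w ^+ n *: ('X^(n * n.-1 + n * n.*2.-1) *
    \prod_(i < n) ((1 + w *: 'X^(i.*2.+1)) * (1 + w^-1 *: 'X^(i.*2.+1)))).
Proof.
move=> w0; rewrite -addnn big_split_ord /= addnn.
have -> : \prod_(i < n) ('X^(n.*2.-1) + w%:P * 'X^2 ^+ i) =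
    w ^+ n *: ('X^(n * n.-1) * \prod_(i < n) (1 + w^-1 *: 'X^(i.*2.+1))).
  rewrite scalerAl.
  have -> : w ^+ n *: 'X^(n * n.-1) = \prod_(i < n) (w *: 'X^(2 * i)).
    rewrite scaler_prod prodr_const card_ord prodrXr; congr (_ *: 'X^_).
    rewrite -big_distrr /=.
    elim: n => [|n IH]; first by rewrite big_ord0.
    by rewrite big_ord_recr mulnDr /= -IH; case: n {IH} => [|n]; lia.
  rewrite [X in _ * X](reindex_inj rev_ord_inj) -big_split /=.
  apply: eq_bigr => i _; rewrite -exprM mulrDr mulr1 -scalerAl -scalerAr.
  rewrite scalerA mulfV // scale1r -exprD addrC mul_polyC.
  by congr (_ + 'X^_); case: i => i /= lt_in; lia.
have -> : \prod_(i < n) ('X^(n.*2.-1) + w%:P * 'X^2 ^+ (n + i)) =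
    'X^(n * n.*2.-1) * \prod_(i < n) (1 + w *: 'X^(i.*2.+1)).
  have -> : 'X^(n * n.*2.-1) = \prod_(i < n) 'X^(n.*2.-1) :> {poly F}.
    by rewrite prodr_const card_ord -exprM mulnC.
  rewrite -big_split /=; apply: eq_bigr => i _.
  rewrite mulrDr mulr1 -scalerAr -exprM -exprD mul_polyC.
  by congr (_ + _ *: 'X^_); case: i => i /= lt_in; lia.
by rewrite -scalerAl big_split exprD /=; congr (_ *: _); ring.
Qed.

Lemma jacobi_triple w n : w != 0 -> eqX n.*2.+1 (tprod w n) (theta w n).
Proof.
move=> w0; apply: (@eqX_cancelXn _ _ (n * n.-1 + n * n.*2.-1)).
set c := (n * n.-1 + n * n.*2.-1)%N.
suff: eqX (c + n.*2.+1) (w ^+ n *: ('X^c * tprod w n))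
    (\sum_(k < n.*2.+1) w ^+ k *: 'X^(c + sqdist k n)).
  move=> /(eqXM (eqX_refl _ (w ^- n)%:P)).
  rewrite !mul_polyC scalerA mulVf ?expf_neq0 // scale1r => /eqX_trans; apply.
  rewrite /theta mulr_sumr scaler_sumr; apply: eqX_sum => k.
  by rewrite scalerA -scalerAr -exprD mulrC eqX_refl.
rewrite /tprod mulrA scalerAl -jacobi_product // qbin_theorem mulr_suml.
apply: eqX_sum => -[k /= lt_k].
have unit0 m : (tpoch ('X^2 : {poly F}) m)`_0 != 0.
  by rewrite tpoch_coef0 ?oner_eq0.
apply: (@eqX_cancel _ _ (tpoch 'X^2 k * tpoch 'X^2 (n.*2 - k))).
  by rewrite coef0M mulf_neq0.
set T := tpoch _.
have -> : T k * T (n.*2 - k)%N *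
    (qbin 'X^2 n.*2 k * 'X^(n.*2.-1) ^+ (n.*2 - k) * w%:P ^+ k * T n) =
    'X^(c + sqdist k n) * ((T n.*2 * T n) * (w ^+ k)%:P).
  rewrite /c -jacobi_exponent // exprD !exprM.
  transitivity ((qbin 'X^2 n.*2 k * T k * T (n.*2 - k)%N) *
    'X^(n.*2.-1) ^+ (n.*2 - k) * w%:P ^+ k * T n); first by ring.
  by rewrite qbin_tpoch // -/T rmorphXn /=; ring.
have -> : T k * T (n.*2 - k)%N * (w ^+ k *: 'X^(c + sqdist k n)) =
   'X^(c + sqdist k n) * ((T k * T (n.*2 - k)%N) * (w ^+ k)%:P).
  by rewrite -mul_polyC; ring.
(* It remains to compare T(2n) T(n) with T(k) T(2n-k). All indices are at least n - d, so both are
   T(n-d)^2 modulo X^(2(n-d+1)). The factor X^(d^2) makes up for the loss: d^2 + 2(n-d+1) = (d-1)^2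
   + 2n + 1. *)
pose d := ((k - n) + (n - k))%N.
apply: (@eqX_leq _ _ ((c + sqdist k n) + 2 * (n - d).+1)).
  rewrite /sqdist -/d -mulnn.
  have : (2 * d <= d * d + 1)%N by move: d => [|[|d]] //; nia.
  have : (d <= n)%N by rewrite /d; lia.
  lia.
apply: eqX_mulXn; apply: eqXM; last exact: eqX_refl.
have stable m : (n - d <= m)%N -> eqX (2 * (n - d).+1) (T m) (T (n - d)%N).
  exact: eqX_tpoch.
apply: (@eqX_trans _ _ (T (n - d)%N * T (n - d)%N)).
  by apply: eqXM; apply: stable; lia.
by apply: eqX_sym; apply: eqXM; apply: stable; lia.
Qed.

End JacobiTripleProduct.

(** * Even parts of products of theta series *)

Section EvenPart.
Variable F : fieldType.
Implicit Types (w : F) (p q : {poly F}).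

Lemma even_polyM_comp p q : even_poly (p * (q \Po 'X^2)) = even_poly p * q.
Proof.
have evenK u : even_poly (u \Po 'X^2 : {poly F}) = u.
  apply/polyP => i; rewrite coef_even_poly coef_comp_poly_Xn //.
  by rewrite -muln2 dvdn_mull // mulnK.
have odd0 u : odd_poly (u \Po 'X^2 : {poly F}) = 0.
  apply/polyP => i; rewrite coef_odd_poly coef_comp_poly_Xn // coef0.
  by rewrite dvdn2 /= odd_double.
rewrite -{1}[p]poly_even_odd mulrDl mulrAC -!comp_polyM even_polyD.
by rewrite even_polyMX evenK odd0 mul0r addr0.
Qed.

(** The last coefficient used is 2(N-1); for N = n+1 this needs exactly the order 2n+1 of
    [jacobi_triple]. *)
Lemma eqX_even N p q : eqX N.*2.-1 p q -> eqX N (even_poly p) (even_poly q).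
Proof.
move=> /eqXP pq; apply/eqXP => i lt_iN.
by rewrite !coef_even_poly pq //; lia.
Qed.

Lemma sqdistE k n : (sqdist k n + 2 * (k * n) = k * k + n * n)%N.
Proof.
rewrite /sqdist -mulnn; have [le_kn|/ltnW le_nk] := leqP k n.
  have [d ->] : exists d, n = (k + d)%N by exists (n - k)%N; lia.
  have -> : (k - (k + d) + (k + d - k) = d)%N by lia.
  lia.
have [d ->] : exists d, k = (n + d)%N by exists (k - n)%N; lia.
have -> : (n + d - n + (n - (n + d)) = d)%N by lia.
lia.
Qed.

(* The rotation of the square lattice by 45 degrees, centred at [(n, n)]. *)
Lemma sqdist_rot n k l r s : (k + s = r + n -> l + n = r + s ->
  sqdist k n + sqdist l n = 2 * (sqdist r n + sqdist s n))%N.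
Proof.
move=> ek el; have := sqdistE k n; have := sqdistE l n.
have := sqdistE r n; have := sqdistE s n.
have Ek : (k%:Z = r%:Z + n%:Z - s%:Z)%R by lia.
have El : (l%:Z = r%:Z + s%:Z - n%:Z)%R by lia.
nia.
Qed.

Lemma leq_sqdist k n : ((k - n) + (n - k) <= sqdist k n)%N.
Proof. by rewrite /sqdist -mulnn; nia. Qed.

Lemma odd_sqdist k n : odd (sqdist k n) = odd k (+) odd n.
Proof.
have := congr1 odd (sqdistE k n).
by rewrite mul2n oddD odd_double addbF oddD !oddM !andbb.
Qed.

Lemma theta_mul_coef (u v : F) n i : (theta u n * theta v n)`_i =
  \sum_(x : 'I_n.*2.+1 * 'I_n.*2.+1 | (sqdist x.1 n + sqdist x.2 n == i)%N)
    (u ^+ x.1 / u ^+ n) * (v ^+ x.2 / v ^+ n).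
Proof.
rewrite /theta mulr_suml coef_sum [RHS]big_mkcond.
rewrite -(pair_bigA _ (fun a b : 'I_n.*2.+1 =>
  if (sqdist a n + sqdist b n == i)%N
  then (u ^+ a / u ^+ n) * (v ^+ b / v ^+ n) else 0)) /=.
apply: eq_bigr => a _; rewrite mulr_sumr coef_sum; apply: eq_bigr => b _.
rewrite -scalerAl -scalerAr scalerA -exprD coefZ coefXn eq_sym.
by case: eqP => _; rewrite ?mulr1 ?mulr0.
Qed.

Lemma even_theta w n : w != 0 ->
  eqX n.+1 (even_poly (theta 1 n * theta w n)) (theta w n ^+ 2).
Proof.
move=> w0; apply/eqXP => e; rewrite ltnS => le_en.
rewrite coef_even_poly expr2 !theta_mul_coef; apply: esym.
(* In coordinates centred at (n, n), [h] sends (j, k) to ((j+k)/2, (k-j)/2), and [g] sends (r, s) to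
   (r-s, r+s). *)
pose h (x : 'I_n.*2.+1 * 'I_n.*2.+1) : 'I_n.*2.+1 * 'I_n.*2.+1 :=
  (inord (x.2 + x.1)./2, inord (x.2 + n.*2 - x.1)./2).
pose g (x : 'I_n.*2.+1 * 'I_n.*2.+1) : 'I_n.*2.+1 * 'I_n.*2.+1 :=
  (inord (x.1 + n - x.2), inord (x.1 + x.2 - n)).
have h1 x : (h x).1 = (x.2 + x.1)./2 :> nat.
  by rewrite /h /= inordK //; case: x => [[k ?] [l ?]] /=; lia.
have h2 x : (h x).2 = (x.2 + n.*2 - x.1)./2 :> nat.
  by rewrite /h /= inordK //; case: x => [[k ?] [l ?]] /=; lia.
(* Here |r| + |s| <= r^2 + s^2 <= n, so no subtraction truncates and [inord] stays in range. *)
have gP (x : 'I_n.*2.+1 * 'I_n.*2.+1) : (sqdist x.1 n + sqdist x.2 n <= n)%N ->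
    ((g x).1 = x.1 + n - x.2 :> nat)%N /\ ((g x).2 = x.1 + x.2 - n :> nat)%N
    /\ (x.2 <= x.1 + n)%N /\ (n <= x.1 + x.2)%N.
  move=> le_n; have := leq_sqdist x.1 n; have := leq_sqdist x.2 n => ? ?.
  by rewrite /g /= !inordK; lia.
have pairE (x y : 'I_n.*2.+1 * 'I_n.*2.+1) :
    (x == y) = (x.1 == y.1 :> nat) && (x.2 == y.2 :> nat).
  by case: x y => [? ?] [? ?]; rewrite xpair_eqE.
rewrite (reindex_onto h g) => [|x /eqP Qx]; last first.
  have [|g1 [g2 [? ?]]] := gP x; first by rewrite Qx.
  by apply/eqP; rewrite pairE h1 h2 g1 g2; lia.
apply: eq_big => [x|x /andP[/eqP Qx /eqP gx]].
  apply/andP/eqP => [[/eqP Qx /eqP gx]|Px].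
    have [|g1 [g2 [? ?]]] := gP (h x); first by rewrite Qx.
    rewrite gx in g1 g2.
    have := @sqdist_rot n x.1 x.2 (h x).1 (h x).2; rewrite Qx mul2n; apply.
      by rewrite g1 subnK.
    by rewrite g2 subnK.
  (* The total exponent 2e is even, so the halvings in [h] are exact. *)
  have par : odd x.1 = odd x.2.
    move: (congr1 odd Px); rewrite oddD !odd_sqdist odd_double.
    by case: odd; case: odd; case: odd.
  have half_rot (k l : nat) : (k < n.*2.+1)%N -> odd k = odd l ->
      (k + (l + n.*2 - k)./2 = (l + k)./2 + n)%N /\
      (l + n = (l + k)./2 + (l + n.*2 - k)./2)%N by lia.
  have [E1 E2] := half_rot x.1 x.2 (ltn_ord _) par.
  rewrite -!h1 -!h2 in E1 E2.
  have Qx : (sqdist (h x).1 n + sqdist (h x).2 n = e)%N.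
    by move: (sqdist_rot E1 E2); rewrite Px mul2n => /double_inj.
  split; first exact/eqP.
  have [|g1 [g2 _]] := gP (h x); first by rewrite Qx.
  by rewrite pairE g1 g2 -E1 -E2 !addnK !eqxx.
have [|g1 [g2 [? ?]]] := gP (h x); first by rewrite Qx.
rewrite gx in g2; rewrite !expr1n divr1 mul1r mulrACA -exprD -invfM -exprD.
apply/eqP; rewrite eqr_div ?expf_neq0 // -!exprD; apply/eqP; congr (_ ^+ _).
by rewrite g2 -[X in (X + _)%N](subnK (_ : n <= (h x).1 + (h x).2)%N) // addnA.
Qed.

End EvenPart.

(** * Theta products at 1, -1 and a sixth root of unity *)

Section ThetaProducts.
Variable F : fieldType.
Implicit Type w : F.
Let T k n : {poly F} := tpoch 'X^k n.

Lemma tprodN1 n : tprod (-1) n * T 2 n = T 1 n.*2 ^+ 2.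
Proof.
rewrite /tprod /T expr1 -tpoch_double /tpoch invrN1.
under eq_bigr => i _ do rewrite scaleN1r.
by rewrite big_split /=; ring.
Qed.

(** As w + 1/w = 1, (1 + wY)(1 + Y/w)(1 - Y) = (1 + Y + Y^2)(1 - Y) = 1 - Y^3. *)
Lemma tprod_cubic w n : w != 0 -> w ^+ 2 = w - 1 ->
  tprod w n * T 1 n.*2 * T 6 n = T 2 n ^+ 2 * T 3 n.*2.
Proof.
move=> w0 ww; rewrite /T expr1 -!tpoch_double -exprM /tprod -!/(tpoch _ _).
have -> : \prod_(i < n) (1 - 'X^3 ^+ i.*2.+1) =
  \prod_(i < n) ((1 + w *: 'X^(i.*2.+1)) * (1 + w^-1 *: 'X^(i.*2.+1))) *
  \prod_(i < n) (1 - 'X^(i.*2.+1)) :> {poly F}.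
  rewrite -big_split /=; apply: eq_bigr => i _.
  rewrite -exprM mulnC exprM; set Y := 'X^_.
  have vw : w^-1 = 1 - w.
    by apply: (mulfI w0); rewrite divff // mulrBr -expr2 ww; ring.
  have WW : w%:P ^+ 2 = w%:P - 1 :> {poly F} by rewrite -rmorphXn /= ww rmorphB.
  rewrite vw -!mul_polyC rmorphB /= rmorph1.
  transitivity ((1 + Y + (w%:P - w%:P ^+ 2) * Y ^+ 2) * (1 - Y)); last by ring.
  by rewrite WW; ring.
by ring.
Qed.

(** Since (1+Y)^2 (1-Y)^2 = (1-Y^2)^2, only even powers occur; the composition is the form that
    [even_polyM_comp] takes. *)
Lemma tprod1N1 n : tprod 1 n * tprod (-1) n =
  ((\prod_(i < n) (1 - 'X^(i.*2.+1))) ^+ 2 * T 1 n ^+ 2) \Po 'X^2 :> {poly F}.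
Proof.
have eX k : (1 - 'X^k) \Po 'X^2 = 1 - 'X^2 ^+ k :> {poly F}.
  by rewrite comp_polyB comp_polyC comp_Xn_poly.
rewrite comp_polyM !rmorphXn /T expr1 /tpoch !rmorph_prod /=.
under [X in X ^+ 2 * _]eq_bigr => i _ do rewrite eX.
under [X in _ * X ^+ 2]eq_bigr => i _ do rewrite eX.
rewrite /tprod -/(tpoch _ n) mulrACA -big_split -expr2 /=; congr (_ * _).
rewrite -[RHS]prodrXl.
apply: eq_bigr => i _; rewrite invr1 invrN1 scaleN1r scale1r -exprM mulnC exprM.
by ring.
Qed.

End ThetaProducts.

(** * Transfer to integer sequences and conclusion *)

Definition agree (N : nat) (a : nat -> int) (p : {poly algC}) :=
  forall i, (i < N)%N -> p`_i = (a i)%:~R.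

Lemma agree_mul N a b p q :
  agree N a p -> agree N b q -> agree N (fps_mul a b) (p * q).
Proof.
move=> ap bq i lt_iN; rewrite coefM /fps_mul rmorph_sum; apply: eq_bigr => j _.
by rewrite rmorphM /= ap ?bq //; case: j => j /=; lia.
Qed.

Lemma agree_exp N a p m : agree N a p -> agree N (fps_exp a m) (p ^+ m).
Proof.
move=> ap; elim: m => [|m IH]; last by rewrite exprS; apply: agree_mul.
by move=> i _; rewrite expr0 coef1 /=; case: (i == 0%N).
Qed.

Lemma agree_f k m : (0 < k)%N -> agree (k * m.+1) (f_ k) (tpoch 'X^k m).
Proof.
move=> k0 i lt_i.
have -> : (f_ k i)%:~R = (tpoch ('X^k : {poly algC}) i)`_i.
  have -> : tpoch ('X^k : {poly algC}) i =
      map_poly intr (\prod_(1 <= j < i.+1) (1 - 'X^(k * j)) : {poly int}).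
    rewrite rmorph_prod big_add1 big_mkord; apply: eq_bigr => j _.
    by rewrite rmorphB rmorph1 /= map_polyXn exprM.
  by rewrite coef_map.
(* The two products have i and m factors; those beyond the shorter one do not reach degree i. *)
have [le_im|/ltnW le_mi] := leqP i m.
  by apply: (eqXP _ _ _ (eqX_tpoch _ k le_im)); nia.
by apply/esym; apply: (eqXP _ _ _ (eqX_tpoch _ k le_mi)).
Qed.

Lemma exists_cubic : exists w : algC, w != 0 /\ w ^+ 2 = w - 1.
Proof.
(* The list encodes the equation w^2 = -1 + w. *)
have [w ww] := @solve_monicpoly algC 2 (nth 0 [:: -1; 1]) isT.
exists w; move: ww; rewrite !big_ord_recl big_ord0 /= expr0 expr1 => ww.
have e : w ^+ 2 = w - 1 by rewrite ww; ring.
split => //; apply: contra_eqN e => /eqP ->.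
by rewrite expr0n /= sub0r eq_sym oppr_eq0 oner_eq0.
Qed.

(* a = P_{1^{-3}2^3 3^1 6^{-1}} is characterized (uniquely, since f_1^3 f_6
   has constant term 1) by  (sum a_n q^n) * f_1^3 f_6 = f_2^3 f_3. *)
Theorem theorem3p6 (a : nat -> int) :
  fps_mul a (fps_mul (fps_exp (f_ 1) 3) (f_ 6)) =
    fps_mul (fps_exp (f_ 2) 3) (f_ 3) ->
  convolutive 2 a.
Proof.
move=> fps_eq n; have [w [w0 ww]] := exists_cubic.
pose T k m : {poly algC} := tpoch 'X^k m.
(* The order 2n+1 just keeps the coefficient of index 2n. *)
pose N := n.*2.+1; pose A : {poly algC} := \poly_(i < N) (a i)%:~R.
have aA : agree N a A by move=> i lt_i; rewrite coef_poly lt_i.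
have aT k m : (0 < k)%N -> (N <= k * m.+1)%N -> agree N (f_ k) (T k m).
  by move=> k0 le_N i lt_i; apply: agree_f => //; apply: leq_trans le_N.
have eqA : eqX N (A * (T 1 n.*2 ^+ 3 * T 6 n)) (T 2 n ^+ 3 * T 3 n.*2).
  apply/eqXP => i lt_i.
  transitivity ((fps_mul (fps_exp (f_ 2) 3) (f_ 3) i)%:~R : algC).
    rewrite -fps_eq; apply: (agree_mul (N := N)) => //.
    by apply: agree_mul; [apply: agree_exp|]; apply: aT; rewrite // /N; lia.
  apply/esym; apply: (agree_mul (N := N)) => //.
    by apply: agree_exp; apply: aT; rewrite // /N; lia.
  by apply: aT; rewrite // /N; lia.
have T0 k m : (0 < k)%N -> (T k m)`_0 != 0.
  by move=> k0; rewrite /T tpoch_coef0 ?oner_eq0.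
set L := tprod (1 : algC) n; pose M := tprod (-1 : algC) n; pose W := tprod w n.
have eqM : M * T 2 n = T 1 n.*2 ^+ 2 := tprodN1 _ n.
have eqW : W * T 1 n.*2 * T 6 n = T 2 n ^+ 2 * T 3 n.*2 := tprod_cubic n w0 ww.
have AM : eqX N (A * M) W.
  apply: (@eqX_cancel _ _ (T 1 n.*2 * T 6 n * T 2 n)).
    by rewrite !coef0M !mulf_neq0 ?T0.
  have -> : T 1 n.*2 * T 6 n * T 2 n * (A * M) = A * (T 1 n.*2 ^+ 3 * T 6 n).
    by rewrite [in RHS]exprS -eqM; ring.
  have -> : T 1 n.*2 * T 6 n * T 2 n * W = T 2 n ^+ 3 * T 3 n.*2.
    by transitivity (T 2 n * (W * T 1 n.*2 * T 6 n)); [|rewrite eqW]; ring.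
  exact: eqA.
have M0 : M`_0 != 0.
  have := congr1 (fun p : {poly algC} => p`_0) eqM; rewrite /= expr2 !coef0M.
  by apply: contra_eq_neq => ->; rewrite mul0r eq_sym mulf_neq0 ?T0.
have even_tprod u : u != 0 ->
    eqX n.+1 (even_poly (L * tprod u n)) (tprod u n ^+ 2).
  move=> u0; have Ju := jacobi_triple n u0.
  have J1 := jacobi_triple n (oner_neq0 algC).
  apply: (@eqX_trans _ _ (theta u n ^+ 2)).
    apply: eqX_trans (even_theta n u0); apply: eqX_even.
    exact: eqXM.
  by apply: eqX_sym; apply: eqXX; apply: eqX_leq Ju; lia.
have evA : eqX n.+1 (even_poly A) (A ^+ 2).
  apply: (@eqX_cancel _ _ (M ^+ 2)); first by rewrite expr2 coef0M mulf_neq0.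
  (* [L * M] is H(X^2), so [H] is its even part, congruent to M^2 by the case u = -1. Then even(A) H
     = even(A L M), which is congruent to even(L W), to W^2 and to (A M)^2. *)
  have LM := tprod1N1 algC n; set H := (X in X \Po _) in LM.
  have eqH : eqX n.+1 H (M ^+ 2).
    have := even_tprod (-1); rewrite /L LM.
    rewrite -[X in even_poly X]mul1r even_polyM_comp even_polyC mul1r; apply.
    by rewrite oppr_eq0 oner_eq0.
  apply: (@eqX_trans _ _ (even_poly A * H)).
    by rewrite mulrC; apply: eqXM (eqX_refl _ _) (eqX_sym eqH).
  rewrite -even_polyM_comp -LM.
  apply: (@eqX_trans _ _ (even_poly (L * W))).
    apply: eqX_even; have -> : A * (tprod 1 n * tprod (-1) n) = L * (A * M).
      by rewrite /L /M; ring.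
    exact: eqXM (eqX_refl _ _) AM.
  apply: (eqX_trans (even_tprod w w0)).
  rewrite -exprMn [M * A]mulrC; apply: eqXX; apply: eqX_sym.
  by apply: eqX_leq AM; rewrite /N; lia.
move/eqXP: evA => /(_ n (ltnSn n)); rewrite coef_even_poly aA ?ltnSn //.
rewrite (agree_exp (N := N) 2 aA) => [/intr_inj|]; last by rewrite /N; lia.
by rewrite -mul2n.
Qed.
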